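(* Let $x$ be a variable, and for $\nu\in\{0,1,2\}$ and $k\ge0$ let $c_k^{(\nu)}=E_{2k+\nu}\!\left(\frac{x+1}{2}\right)$, where $E_m(\cdot)$ is the $m$th Euler polynomial. For $\ell\ge 1$ let $\tau_{\ell}^{(\nu)}=\frac{\ell^{2}}{4}\left(x^{2}-(2\ell+\nu-1)^{2}\right)$. Then for all integers $n\geq 0$ and $\nu=0,1,2$, $$H_n(c_k^{(\nu)})=(-1)^{\binom{n+1}{2}}\,E_{\nu}\!\left(\tfrac{x+1}{2}\right)^{n+1}\prod_{\ell=1}^n\left(\tau_{\ell}^{(\nu)}\right)^{n+1-\ell},$$ or more explicitly, $$H_n(c_k^{(0)}) = (-1)^{\binom{n+1}{2}}\prod_{\ell=1}^n\left(\frac{\ell^2}{4}\big(x^2-(2\ell-1)^2\big)\right)^{n+1-\ell},$$ $$H_n(c_k^{(1)}) = (-1)^{\binom{n+1}{2}}\left(\frac{x}{2}\right)^{n+1}\prod_{\ell=1}^n\left(\frac{\ell^2}{4}\big(x^2-(2\ell)^2\big)\right)^{n+1-\ell},$$ $$H_n(c_k^{(2)}) = (-1)^{\binom{n+1}{2}}\left(\frac{x^{2}-1}{4}\right)^{n+1}\prod_{\ell=1}^{n}\left(\frac{\ell^{2}}{4}\big(x^{2}-(2\ell+1)^{2}\big)\right)^{n+1-\ell}.$$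
   Context: The Euler polynomials are defined by $\frac{2e^{xt}}{e^t+1}=\sum_{n\ge 0}E_n(x)\frac{t^n}{n!}$. For a sequence $(c_k)_{k\ge 0}$ of numbers or polynomials, the $n$th Hankel determinant is $H_n(c_k)=\det_{0\le i,j\le n}(c_{i+j})$, the determinant of an $(n+1)\times(n+1)$ matrix. Empty products equal $1$. *)

(* Defs.v *)
From mathcomp Require Import all_boot all_order all_algebra.

Set Implicit Arguments.
Unset Strict Implicit.
Unset Printing Implicit Defensive.

Import GRing.Theory Num.Theory.
Local Open Scope ring_scope.

(* A formal power series \sum_n (a n) t^n over R is its coefficient sequence
   a : nat -> R. *)
Section PowerSeries.
Variable R : comUnitRingType.
Implicit Types a b : nat -> R.

Definition fps_mul a b : nat -> R := fun n => \sum_(i < n.+1) a i * b (n - i)%N.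

(* The first n coefficients of a^-1, obtained by solving
   \sum_(k <= m) a (m - k) * b k = (m == 0) for b m, m = 0, 1, ... *)
Fixpoint fps_inv_seq a (n : nat) : seq R :=
  if n is m.+1 then
    let s := fps_inv_seq a m in
    rcons s ((a 0%N)^-1 * ((m == 0%N)%:R - \sum_(k < m) a (m - k)%N * s`_k))
  else [::].

(* Multiplicative inverse; meaningful only if a 0 is a unit. *)
Definition fps_inv a : nat -> R := fun n => (fps_inv_seq a n.+1)`_n.

Lemma size_fps_inv_seq a n : size (fps_inv_seq a n) = n.
Proof. by elim: n => //= n IHn; rewrite size_rcons IHn. Qed.

Lemma nth_fps_inv_seq a n k : (k < n)%N -> (fps_inv_seq a n)`_k = fps_inv a k.
Proof.
elim: n => // n IHn; rewrite ltnS leq_eqVlt => /orP[/eqP -> //|lt_kn].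
by rewrite [fps_inv_seq a n.+1]/= nth_rcons size_fps_inv_seq lt_kn IHn.
Qed.

Lemma fps_mulC a b : fps_mul a b =1 fps_mul b a.
Proof.
move=> n; rewrite /fps_mul (reindex_inj rev_ord_inj) /=.
by apply: eq_bigr => i _; rewrite subSS subKn -1?ltnS // mulrC.
Qed.

Lemma fps_mulA a b c :
  fps_mul a (fps_mul b c) =1 fps_mul (fps_mul a b) c.
Proof.
move=> n; rewrite /fps_mul.
pose P (d : nat -> R) := \poly_(i < n.+1) d i.
have PE d e m : (m < n.+1)%N -> (P d * P e)`_m = fps_mul d e m.
  move=> lt_mn; rewrite coefM; apply: eq_bigr => i _; rewrite !coef_poly.
  by rewrite (leq_ltn_trans _ lt_mn) ?leq_ord // (leq_ltn_trans _ lt_mn) ?leq_subr.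
have -> : \sum_(i < n.+1) a i * fps_mul b c (n - i)%N = (P a * (P b * P c))`_n.
  rewrite coefM; apply: eq_bigr => i _.
  by rewrite coef_poly ltn_ord PE // ltnS leq_subr.
have -> // : \sum_(i < n.+1) fps_mul a b i * c (n - i)%N = (P a * P b * P c)`_n.
  rewrite coefM; apply: eq_bigr => i _.
  by rewrite PE // coef_poly ltnS leq_subr.
by rewrite mulrA.
Qed.

Lemma fps_mulV a : a 0%N \is a GRing.unit ->
  fps_mul a (fps_inv a) =1 fun n => (n == 0%N)%:R.
Proof.
move=> ua n; rewrite fps_mulC /fps_mul big_ord_recr /= subnn.
rewrite {2}/fps_inv /= nth_rcons size_fps_inv_seq ltnn eqxx.
rewrite mulrAC mulVr // mul1r.
under [X in _ - X]eq_bigr => k _ do rewrite nth_fps_inv_seq // mulrC.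
by rewrite addrC subrK.
Qed.

End PowerSeries.

(* e^{pt} for p in Q[x]. *)
Definition fps_exp (p : {poly rat}) : nat -> {poly rat} :=
  fun n => (n`!%:R)^-1 *: p ^+ n.

(* e^t + 1 *)
Definition fps_exp1D1 : nat -> {poly rat} :=
  fun n => fps_exp 1 n + (n == 0%N)%:R.

(* 2 e^{xt} / (e^t + 1) in Q[x][[t]] *)
Definition euler_gf : nat -> {poly rat} :=
  fps_mul (fun n => 2%:R * fps_exp 'X n) (fps_inv fps_exp1D1).

Definition euler_poly (n : nat) : {poly rat} := n`!%:R *: euler_gf n.

Lemma euler_gfP :
  fps_mul (fun n => (n`!%:R)^-1 *: euler_poly n) fps_exp1D1
    =1 fun n => 2%:R * fps_exp 'X n.
Proof.
have u0 : fps_exp1D1 0%N \is a GRing.unit.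
  rewrite /fps_exp1D1 /fps_exp fact0 invr1 scale1r expr0 /=.
  by rewrite -polyC1 -polyCD poly_unitE size_polyC coefC.
move=> n.
transitivity (fps_mul euler_gf fps_exp1D1 n).
  apply: eq_bigr => i _; congr (_ * _).
  by rewrite scalerA mulVf ?scale1r // pnatr_eq0 -lt0n fact_gt0.
rewrite -fps_mulA {1}/fps_mul.
under eq_bigr => i _ do rewrite fps_mulC fps_mulV //.
rewrite big_ord_recr big1 => [|i _] /=; first by rewrite add0r subnn mulr1.
by rewrite subn_eq0 leqNgt ltn_ord mulr0.
Qed.

(* Order n.+1, as in det_{0 <= i, j <= n}. *)
Definition hankel (R : comNzRingType) (n : nat) (c : nat -> R) : R :=
  \det (\matrix_(i < n.+1, j < n.+1) c (i + j)%N).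

(* E_m((x + 1) / 2) *)
Definition euler_half (m : nat) : {poly rat} :=
  euler_poly m \Po (2%:R^-1 *: ('X + 1)).

Definition c_seq (nu k : nat) : {poly rat} := euler_half (2 * k + nu)%N.

(* The subtraction is in rat, not truncated. *)
Definition tau (nu l : nat) : {poly rat} :=
  (l%:R ^+ 2 / 4%:R) *: ('X^2 - ((2%:R * l%:R + nu%:R - 1) ^+ 2)%:P).

(* Main.v *)
Require Import Defs.
From HB Require Import structures.
From mathcomp Require Import all_boot all_order all_algebra.
From mathcomp Require Import ring.

(** Write b = (1 - x) / 2 and c = (1 + x) / 2, so that b + c = 1, and let F be
    the linear functional on Q[x][y] with F(y^m) = E_m(c).  Multiplying the
    generating function of the Euler polynomials by e^t + 1 shows that F is
    governed by a single identity,
      F(p(y + 1) + p(y)) = 2 p(c)   for every polynomial p.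
    The relations between Gram entries below are instances with p(c) = 0.

    The Hankel matrix of E_{2k+nu}(c) is the Gram matrix of the powers s^i for
    the functional L(q) = F(y^nu q(y^2)).  Its determinant is unchanged when
    the powers are replaced, independently for rows and for columns, by other
    monic polynomials of the same degrees (hankel_monic).  This problem is one
    of continuous dual Hahn polynomials, with parameters nu/2, b and c; for
    them the right choice is
      P_i(s) = prod_{k<i} (s - (b + k)^2)  for the rows,
      Q_j(s) = prod_{k<j} (s - (c + k)^2)  for the columns,
    since then every Gram entry is a product.  Indeed y^2 - (a + k)^2 factors
    into two linear factors in y, and a shift of y by 1 moves the window of
    roots by one step; as b + c = 1, the factors gained for b and those gained
    for c fit together (rise_fall_shift2).  Telescoping through F yields, with
    B = b + i and C = c + j,
      L(P_i Q_j (s + B C + nu (B + C) / 2)) = 0.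
    This is where nu <= 2 enters: it takes an auxiliary factor 1, y - 1/2 or
    y^2 - y, one for each nu.  The relation gives L(P_{i+1} Q_j) and
    L(P_i Q_{j+1}) as multiples of L(P_i Q_j), hence, with rising factorials,
      L(P_i Q_j) = (-1)^(i+j) (i+j)! (b + nu/2)_i (c + nu/2)_j E_nu(c).
    The row and column factors come out of the determinant.  There remains
    det (i+j)! = prod_i i!^2, which is the statement that the Pascal matrix
    has determinant 1.  The product over i of i!^2 (b + nu/2)_i (c + nu/2)_i
    regroups into powers of the - tau_l. *)

Set Implicit Arguments.
Unset Strict Implicit.
Unset Printing Implicit Defensive.

Import GRing.Theory Num.Theory.
Local Open Scope ring_scope.

(** * Moment functionals and Hankel determinants *)

Section Moment.
Variables (R : comNzRingType) (c : nat -> R).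
Implicit Types p q : {poly R}.

Definition moment (p : {poly R}) : R := \sum_(k < size p) p`_k * c k.

Lemma moment_widen (m : nat) p :
  (size p <= m)%N -> moment p = \sum_(k < m) p`_k * c k.
Proof.
move=> le_pm; rewrite /moment (big_ord_widen m (fun k => p`_k * c k)) //.
rewrite big_mkcond; apply: eq_bigr => k _; case: ltnP => // le_pk.
by rewrite nth_default ?mul0r.
Qed.

Lemma moment_is_scalar : scalar moment.
Proof.
move=> a p q; set m := maxn (size p) (size q).
have le_pm : (size p <= m)%N by rewrite leq_maxl.
have le_qm : (size q <= m)%N by rewrite leq_maxr.
have le_m : (size (a *: p + q)%R <= m)%N.
  apply: leq_trans (size_polyD _ _) _.
  by rewrite geq_max le_qm (leq_trans (size_scale_leq _ _)).
rewrite !(@moment_widen m) // mulr_sumr -big_split /=; apply: eq_bigr => k _.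
by rewrite coefD coefZ mulrDl mulrA.
Qed.

HB.instance Definition _ :=
  GRing.isLinear.Build R {poly R} R *%R moment moment_is_scalar.

Lemma momentZ a p : moment (a *: p) = a * moment p.
Proof. exact: scalarZ. Qed.

Lemma momentXn (k : nat) : moment 'X^k = c k.
Proof.
rewrite (@moment_widen k.+1) ?size_polyXn // big_ord_recr /= coefXn eqxx mul1r.
by rewrite big1 ?add0r // => i _; rewrite coefXn ltn_eqF ?mul0r.
Qed.

(** Expanding P i and Q j in powers of the variable writes the Gram matrix as
    U H V^T, with H the Hankel matrix and U, V unitriangular.  Rows and columns
    may use different families, which is what makes the entries computable. *)
Lemma hankel_monic (n : nat) (P Q : nat -> {poly R}) :
  (forall i, P i \is monic) -> (forall i, size (P i) = i.+1) ->
  (forall i, Q i \is monic) -> (forall i, size (Q i) = i.+1) ->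
  \det (\matrix_(i < n.+1, j < n.+1) moment (P i * Q j)) = hankel n c.
Proof.
have det_coef (S : nat -> {poly R}) : (forall i, S i \is monic) ->
    (forall i, size (S i) = i.+1) ->
    \det (\matrix_(i < n.+1, j < n.+1) (S i)`_j) = 1.
  move=> monS sizeS; rewrite det_trig; last first.
    by apply/is_trig_mxP => i j lt_ij; rewrite mxE nth_default ?sizeS.
  apply: big1 => i _; rewrite mxE; have /monicP := monS i.
  by rewrite lead_coefE sizeS.
move=> monP sizeP monQ sizeQ.
have -> : \matrix_(i < n.+1, j < n.+1) moment (P i * Q j) =
    (\matrix_(i < n.+1, j < n.+1) (P i)`_j) *m
    (\matrix_(i < n.+1, j < n.+1) c (i + j)%N) *m
    (\matrix_(i < n.+1, j < n.+1) (Q i)`_j)^T.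
  apply/matrixP => i j; rewrite !mxE.
  have expand (S : {poly R}) (k : 'I_n.+1) : size S = k.+1 ->
      S = \sum_(l < n.+1) S`_l *: 'X^l.
    move=> sizeS; rewrite -poly_def; apply/polyP => l; rewrite coef_poly.
    by case: ltnP => // le_nl; rewrite nth_default // sizeS (leq_trans _ le_nl).
  rewrite {1}(expand _ _ (sizeP i)) {1}(expand _ _ (sizeQ j)) big_distrlr /=.
  rewrite exchange_big linear_sum /=; apply: eq_bigr => l _.
  rewrite linear_sum mxE mulr_suml; apply: eq_bigr => k _ /=.
  rewrite !mxE -scalerAl -scalerAr -exprD !momentZ momentXn.
  by rewrite mulrCA mulrC.
by rewrite !det_mulmx det_tr !det_coef // mul1r mulr1.
Qed.

End Moment.

Section DetFact.
Variable R : comNzRingType.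

(** By the Vandermonde convolution the symmetric Pascal matrix is A A^T, where
    A is the unitriangular matrix of binomial coefficients. *)
Lemma det_pascal (n : nat) :
  \det (\matrix_(i < n.+1, j < n.+1) ('C(i + j, i)%:R : R)) = 1.
Proof.
pose A := \matrix_(i < n.+1, j < n.+1) ('C(i, j)%:R : R).
have -> : \matrix_(i < n.+1, j < n.+1) ('C(i + j, i)%:R : R) = A *m A^T.
  apply/matrixP => i j; rewrite !mxE addnC -binomial.Vandermonde natr_sum.
  rewrite (big_ord_widen_cond n.+1 xpredT
    (fun k => ('C(j, k) * 'C(i, i - k))%:R)) ?ltn_ord //.
  rewrite big_mkcond; apply: eq_bigr => k _; rewrite !mxE ltnS /=.
  case: leqP => [le_ki|lt_ik]; last by rewrite (bin_small lt_ik) mul0r.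
  by rewrite bin_sub // natrM mulrC.
rewrite det_mulmx det_tr det_trig; last first.
  by apply/is_trig_mxP => i j lt_ij; rewrite mxE bin_small.
by rewrite big1 ?mul1r // => i _; rewrite mxE binn.
Qed.

Lemma det_scale_rows_cols (n : nat) (u v : nat -> R) (M : 'M[R]_n) :
  \det (\matrix_(i < n, j < n) (u i * v j * M i j)) =
  \prod_(i < n) (u i * v i) * \det M.
Proof.
have -> : \matrix_(i < n, j < n) (u i * v j * M i j) =
    diag_mx (\row_(i < n) u i) *m M *m diag_mx (\row_(j < n) v j).
  apply/matrixP => i j; rewrite mul_mx_diag mul_diag_mx !mxE.
  by rewrite mulrAC.
rewrite !det_mulmx !det_diag mulrAC big_split /=.
by congr (_ * _ * _); apply: eq_bigr => i _; rewrite mxE.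
Qed.

End DetFact.

(** * Factorial bases in a squared variable *)

(** The Newton basis for the nodes a^2, (a + 1)^2, and so on: the continuous
    dual Hahn polynomials have closed-form coordinates in it. *)
Definition sqnewton (R : comNzRingType) (a : R) (i : nat) : {poly R} :=
  \prod_(k < i) ('X - ((a + k%:R) ^+ 2)%:P).

Lemma sqnewton_monic (R : comNzRingType) (a : R) i : sqnewton a i \is monic.
Proof. exact: monic_prod_XsubC. Qed.

Lemma size_sqnewton (R : comNzRingType) (a : R) i : size (sqnewton a i) = i.+1.
Proof.
by rewrite /sqnewton size_prod_XsubC /index_enum -enumT size_enum_ord.
Qed.

Lemma sqnewtonS (R : comNzRingType) (a : R) i :
  sqnewton a i.+1 = sqnewton a i * ('X - ((a + i%:R) ^+ 2)%:P).
Proof. by rewrite /sqnewton big_ord_recr. Qed.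

Section Shift.
Variable R : comNzRingType.
Implicit Types a b : R.

Definition rise (a : R) (i : nat) : {poly R} :=
  \prod_(k < i) ('X + (a + k%:R)%:P).
Definition fall (a : R) (i : nat) : {poly R} :=
  \prod_(k < i) ('X - (a + k%:R)%:P).

Lemma fallS a i : fall a i.+1 = fall a i * ('X - (a + i%:R)%:P).
Proof. exact: big_ord_recr. Qed.

Lemma rise_mul_fall a i : rise a i * fall a i = sqnewton a i \Po 'X^2.
Proof.
rewrite -big_split /sqnewton rmorph_prod /=; apply: eq_bigr => k _.
rewrite comp_polyB comp_polyX comp_polyC polyC_exp; ring.
Qed.

(** The window of roots -a, ..., -(a + i - 1) moves by one step, so that the
    outermost factors are exchanged; multiplying by 'X + a avoids a division. *)
Lemma rise_shift a i :
  ('X + a%:P) * (rise a i \Po ('X + 1)) = rise a i * ('X + (a + i%:R)%:P).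
Proof.
rewrite /rise -[RHS](big_ord_recr i (fun k => 'X + (a + k%:R)%:P)).
rewrite big_ord_recl addr0; congr (_ * _).
rewrite rmorph_prod; apply: eq_bigr => k _ /=.
rewrite comp_polyD comp_polyX comp_polyC.
by rewrite /bump /= natrD !polyCD; ring.
Qed.

Lemma fall_shift a i :
  fall a i.+1 \Po ('X + 1) = ('X + (1 - a)%:P) * fall a i.
Proof.
rewrite /fall big_ord_recl comp_polyM comp_polyB comp_polyX comp_polyC addr0.
rewrite polyCB -addrA; congr (_ * _).
rewrite rmorph_prod; apply: eq_bigr => k _ /=.
rewrite comp_polyB comp_polyX comp_polyC.
by rewrite /bump /= natrD !polyCD; ring.
Qed.

(** The shift turns the extra factor of fall b into 'X + 1 - b = 'X + c, which
    is what rise c needs to move its own window, and vice versa: this exchange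
    is the reason for imposing b + c = 1. *)
Lemma rise_fall_shift2 b c i j : b + c = 1 ->
  (rise b i * fall b i.+1 * (rise c j * fall c j.+1)) \Po ('X + 1) =
  rise b i * fall b i * (rise c j * fall c j) *
  (('X + (b + i%:R)%:P) * ('X + (c + j%:R)%:P)).
Proof.
move=> bc1; rewrite !comp_polyM !fall_shift.
have -> : 1 - b = c by rewrite -bc1 addrAC subrr add0r.
have -> : 1 - c = b by rewrite -bc1 addrK.
have := rise_shift b i; have := rise_shift c j.
move: (rise c j \Po _) (rise b i \Po _) => u v Hu Hv.
transitivity ((('X + b%:P) * v) * (('X + c%:P) * u) * (fall b i * fall c j)).
  ring.
rewrite Hu Hv; ring.
Qed.

End Shift.

(** * Gram entries of a functional of Euler type *)

Definition poch (R : comNzRingType) (a : R) (i : nat) : R :=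
  \prod_(k < i) (a + k%:R).

Lemma pochS (R : comNzRingType) (a : R) i :
  poch a i.+1 = poch a i * (a + i%:R).
Proof. exact: big_ord_recr. Qed.

Definition decimate (R : comNzRingType) (m : nat -> R) (nu k : nat) : R :=
  m (2 * k + nu)%N.

Lemma moment_decimate (R : comNzRingType) (m : nat -> R) nu (p : {poly R}) :
  moment (decimate m nu) p = moment m ('X^nu * (p \Po 'X^2)).
Proof.
rewrite -[in RHS](coefK p) poly_def rmorph_sum mulr_sumr linear_sum.
apply: eq_bigr => k _ /=.
rewrite comp_polyZ comp_Xn_poly -scalerAr -exprM -exprD momentZ momentXn.
by rewrite addnC.
Qed.

(** Of the Euler polynomials only the shift identity matters, so the entries are
    computed for any functional satisfying it; h plays the role of 1/2. *)
Section EulerFunctional.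
Variables (R : comNzRingType) (b c h : R) (m : nat -> R).
Hypothesis bDc : b + c = 1.
Hypothesis hDh : h + h = 1.
Hypothesis moment_shift :
  forall p : {poly R}, moment m (p \Po ('X + 1) + p) = 2%:R * p.[c].

(** Let f(y) = P_i(y^2) Q_j(y^2).  For p = f (y - B) (y - C) v the roots of p
    include c, and p(y + 1) = f (y + B) (y + C) v(y + 1).  The factor v is
    chosen so that p(y + 1) + p(y) is twice the polynomial wanted. *)
Lemma moment_sqnewton_rel nu i j (B := b + i%:R) (C := c + j%:R) :
  (nu <= 2)%N ->
  moment (decimate m nu) (sqnewton b i * sqnewton c j *
     ('X + (B * C + nu%:R * h * (B + C))%:P)) = 0.
Proof.
move=> le_nu2; rewrite moment_decimate.
have [v v_shift] : exists v : {poly R},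
    ('X + B%:P) * ('X + C%:P) * (v \Po ('X + 1)) + ('X - B%:P) * ('X - C%:P) * v
    = 2%:R * ('X^nu * ('X^2 + (B * C + nu%:R * h * (B + C))%:P)).
  (* With w(y) = v(y + 1/2) = 1, y, y^2 - 1/4, the parity of w is that of nu,
     and w vanishes at 1/2 when nu = 2, so that y^nu divides the sum. *)
  have h2 : h%:P + h%:P = 1 :> {poly R} by rewrite -polyCD hDh.
  move: (B) (C) => {}B {}C; case: nu le_nu2 => [|[|[|//]]] _.
  - by exists 1; rewrite comp_polyC !mul0r addr0 !polyCM; ring.
  - exists ('X - h%:P); rewrite mul1r comp_polyB comp_polyX comp_polyC.
    have -> : 'X + 1 - h%:P = 'X + h%:P :> {poly R}.
      by rewrite -h2; ring.
    by rewrite !polyCD !polyCM polyCD; ring.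
  - exists ('X^2 - 'X); rewrite comp_polyB comp_Xn_poly comp_polyX.
    have -> : (2%:R * h * (B + C)) = B + C.
      by rewrite mulr_natl mulr2n hDh mul1r.
    by rewrite !polyCD !polyCM; ring.
pose g := rise b i * fall b i.+1 * (rise c j * fall c j.+1) * v.
have := moment_shift g.
have -> : g.[c] = 0.
  have root_c : (fall c j.+1).[c] = 0.
    by rewrite /fall big_ord_recl hornerM addr0 hornerXsubC subrr mul0r.
  by rewrite /g !hornerM root_c !(mul0r, mulr0).
rewrite mulr0 {1}/g comp_polyM rise_fall_shift2 ?bDc //.
set f := rise b i * fall b i * (rise c j * fall c j).
have -> : g = f * (('X - B%:P) * ('X - C%:P) * v).
  by rewrite /g /f !fallS -/B -/C; ring.
rewrite -[f * _ * _]mulrA -mulrDr v_shift !comp_polyM comp_polyD comp_polyX.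
rewrite comp_polyC -!rise_mul_fall -/f (mulrCA f 2%:R) (mulr_natl _ 2) mulr2n.
rewrite linearD /= => dbl0; rewrite (mulrCA 'X^nu).
move: (moment m _) dbl0 => z dbl0.
by rewrite -[z]mul1r -hDh mulrDl -mulrDr dbl0 mulr0.
Qed.

(** Since P_{i+1} = P_i (s - B^2), the previous relation multiplies the
    moment by -(B^2 + B C + nu h (B + C)) = -(B + C) (B + nu h), and
    B + C = 1 + i + j; the step in j is the same with C for B. *)
Lemma moment_sqnewton nu i j : (nu <= 2)%N ->
  moment (decimate m nu) (sqnewton b i * sqnewton c j) =
    (-1) ^+ (i + j) * (i + j)`!%:R * poch (b + nu%:R * h) i *
    poch (c + nu%:R * h) j * m nu.
Proof.
move=> le_nu2; set L := moment (decimate m nu).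
have scale k l (a : R) :
    L (sqnewton b k * sqnewton c l * ('X - (a ^+ 2)%:P)) =
    - (a ^+ 2 + ((b + k%:R) * (c + l%:R)
        + nu%:R * h * (b + k%:R + (c + l%:R)))) *
    L (sqnewton b k * sqnewton c l).
  set d := (X in a ^+ 2 + X).
  have := moment_sqnewton_rel k l le_nu2; rewrite -/d -/L => rel.
  apply/eqP; rewrite mulNr -addr_eq0 -[X in _ == X]rel -momentZ -linearD /=.
  apply/eqP; congr (L _); rewrite -mul_polyC polyCD; ring.
elim: i => [|i IHi].
  elim: j => [|j IHj].
    rewrite /sqnewton /poch !big_ord0 addn0 fact0 expr0 !mul1r.
    by rewrite -(expr0 'X) /L momentXn.
  rewrite sqnewtonS mulrA scale.
  have eB : b = 1 - c by rewrite -bDc addrK.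
  rewrite IHj !add0n pochS factS natrM (exprS (-1) j) -natr1 eB.
  by move: ((-1) ^+ j) => s; ring.
rewrite sqnewtonS mulrAC scale.
have eC : c = 1 - b by rewrite -bDc addrC addKr.
rewrite IHi addSn pochS factS natrM (exprS (-1) (i + j)) -natr1 natrD eC.
by move: ((-1) ^+ (i + j)) => s; ring.
Qed.

(** As (i + j)! = i! j! 'C(i + j, i), the Gram matrix is a rescaled Pascal
    matrix; the signs of row i and of column i cancel. *)
Lemma hankel_decimate nu n : (nu <= 2)%N ->
  hankel n (decimate m nu) =
    m nu ^+ n.+1 * \prod_(i < n.+1)
      \prod_(l < i)
        (l.+1%:R ^+ 2 * (b + nu%:R * h + l%:R) * (c + nu%:R * h + l%:R)).
Proof.
move=> le_nu2.
rewrite -(hankel_monic _ n (sqnewton_monic b) (size_sqnewton b)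
  (sqnewton_monic c) (size_sqnewton c)).
pose u i : R := (-1) ^+ i * i`!%:R * poch (b + nu%:R * h) i * m nu.
pose v i : R := (-1) ^+ i * i`!%:R * poch (c + nu%:R * h) i.
have -> : \matrix_(i < n.+1, j < n.+1)
      moment (decimate m nu) (sqnewton b i * sqnewton c j) =
    \matrix_(i < n.+1, j < n.+1)
      (u i * v j * (\matrix_(i < n.+1, j < n.+1) 'C(i + j, i)%:R) i j).
  apply/matrixP => i j; rewrite !mxE moment_sqnewton //.
  rewrite -(bin_fact (leq_addr j i)) addKn !natrM exprD /u /v; ring.
rewrite det_scale_rows_cols det_pascal mulr1.
rewrite -[X in m nu ^+ X]card_ord -prodr_const -big_split /=.
apply: eq_bigr => i _.
have -> : \prod_(l < i)
      (l.+1%:R ^+ 2 * (b + nu%:R * h + l%:R) * (c + nu%:R * h + l%:R)) =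
    i`!%:R ^+ 2 * poch (b + nu%:R * h) i * poch (c + nu%:R * h) i.
  rewrite 2!big_split /= prodrXl; congr (_ ^+ 2 * _ * _).
  elim: (nat_of_ord i) => [|k IHk]; first by rewrite big_ord0.
  by rewrite big_ord_recr /= IHk factS natrM mulrC.
move: (sqrr_sign R i); rewrite /u /v; move: ((-1) ^+ i) => s s2.
by rewrite -[RHS]mul1r -[X in _ = X * _]s2; ring.
Qed.

End EulerFunctional.

(** The factor t l occurs once for each row i >= l, that is n + 1 - l times; the
    number of signs is the number of pairs 1 <= l <= i <= n. *)
Lemma prod_triangleN (R : comNzRingType) (t : nat -> R) n :
  \prod_(i < n.+1) \prod_(l < i) - t l.+1 =
  (-1) ^+ 'C(n.+1, 2) * \prod_(1 <= l < n.+1) t l ^+ (n.+1 - l).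
Proof.
elim: n => [|n IHn].
  by rewrite big_ord_recr !big_ord0 big_geq // !mul1r.
rewrite big_ord_recr /= IHn [in RHS]binS bin1 exprD -!mulrA; congr (_ * _).
rewrite mulrC prodrN card_ord -mulrA; congr (_ * _).
rewrite big_add1 [X in _ = X]big_add1 /= !big_mkord.
rewrite [X in _ = X]big_ord_recr /= subSn // subnn expr1.
rewrite big_ord_recr /= mulrAC -big_split /=; congr (_ * _).
apply: eq_bigr => i _; rewrite -exprS; congr (_ ^+ _).
by rewrite (@subSn i.+1 n.+1) // ltnS ltnW.
Qed.

(** * The Euler polynomials at (x + 1) / 2 *)

Definition xp : {poly rat} := 2%:R^-1 *: ('X + 1).
Definition xm : {poly rat} := 2%:R^-1 *: (1 - 'X).

Lemma xmDxp : xm + xp = 1.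
Proof.
have e2 : 1 - 'X + ('X + 1) = 2%:R *: 1 :> {poly rat}.
  by rewrite scaler_nat; ring.
by rewrite -scalerDr e2 scalerA mulVf ?scale1r.
Qed.

(** The coefficient of t^m in the product of the generating function by
    e^t + 1, evaluated at (x + 1) / 2. *)
Lemma euler_half_rec (m : nat) :
  \sum_(k < m.+1) 'C(m, k)%:R * euler_half k + euler_half m = 2%:R * xp ^+ m.
Proof.
have natf0 k : (k`!%:R : rat) != 0 by rewrite pnatr_eq0 -lt0n fact_gt0.
have E : \sum_(k < m.+1) 'C(m, k)%:R * euler_poly k + euler_poly m
    = 2%:R * 'X ^+ m.
  have := congr1 (fun p => m`!%:R *: p) (euler_gfP m).
  rewrite /fps_exp -scalerAr scalerA mulfV // scale1r => <-.
  rewrite /fps_mul scaler_sumr.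
  rewrite [X in _ + X](_ : _ =
      \sum_(k < m.+1) (k == m :> nat)%:R * euler_poly k).
    rewrite -big_split /=; apply: eq_bigr => k _.
    have le_km : (k <= m)%N by rewrite -ltnS.
    rewrite -mulrDl -scalerAl (mulrC (euler_poly k)) !scalerAl; congr (_ * _).
    rewrite /fps_exp1D1 /fps_exp expr1n scalerA scalerDr.
    rewrite -(bin_fact le_km) !natrM; congr (_ + _).
      rewrite -[LHS]scaler_nat !scalerA; congr (_ *: _).
      by field; rewrite !natf0.
    rewrite subn_eq0 [(m <= k)%N]leq_eqVlt [(m < k)%N]ltnNge le_km orbF eq_sym.
    case: eqP => [/esym km|_]; last by rewrite scaler0.
    by rewrite km binn subnn !mul1r fact0 mulr1 divff // scale1r.
  rewrite big_ord_recr /= eqxx mul1r big1 ?add0r // => k _.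
  by rewrite ltn_eqF ?mul0r.
have := congr1 (comp_poly xp) E.
rewrite rmorphD rmorph_sum !rmorphM /= rmorphXn /= comp_polyX.
rewrite rmorph_nat => <-; congr (_ + _); apply: eq_bigr => k _.
by rewrite rmorphM rmorph_nat.
Qed.

(** On p = y^m this is the binomial expansion of (y + 1)^m combined with the
    recurrence above. *)
Lemma moment_euler_shift (p : {poly {poly rat}}) :
  moment euler_half (p \Po ('X + 1) + p) = 2%:R * p.[xp].
Proof.
rewrite -[in LHS](coefK p) poly_def horner_coef rmorph_sum -big_split /=.
rewrite linear_sum mulr_sumr; apply: eq_bigr => m _ /=.
rewrite comp_polyZ comp_Xn_poly -scalerDr momentZ [RHS]mulrCA -euler_half_rec.
congr (_ * _); rewrite linearD /= momentXn exprDn_comm ?linear_sum.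
  2: exact: commr1.
congr (_ + _).
rewrite (reindex_inj rev_ord_inj) /=; apply: eq_bigr => k _.
rewrite expr1n mulr1 subSS subKn -1?ltnS // linearMn /= momentXn.
by rewrite bin_sub -1?ltnS // mulr_natl.
Qed.

Definition half : {poly rat} := 2%:R^-1%:P.

Lemma half_D_half : half + half = 1.
Proof. by rewrite -polyCD; congr (_%:P). Qed.

(** With N = 2 l + nu - 1, the difference of squares x^2 - N^2 in tau nu l is
    -(N - x) (N + x), and (N - x) / 2 = b + nu/2 + l - 1,
    (N + x) / 2 = c + nu/2 + l - 1. *)
Lemma tauE nu l :
  - tau nu l.+1 =
  l.+1%:R ^+ 2 * (xm + nu%:R * half + l%:R) * (xp + nu%:R * half + l%:R).
Proof.
have hE : half *+ 2 = 1 by rewrite mulr2n half_D_half.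
have xmE : xm = half * (1 - 'X) by rewrite mul_polyC.
have xpE : xp = half * ('X + 1) by rewrite mul_polyC.
have qE : (l.+1%:R ^+ 2 / 4%:R)%:P = l.+1%:R ^+ 2 * half ^+ 2 :> {poly rat}.
  by rewrite polyCM polyC_exp polyC_natr /half -polyC_exp; congr (_ * _%:P).
have -> : tau nu l.+1 = l.+1%:R ^+ 2 * half ^+ 2 *
    ('X^2 - (2%:R * l.+1%:R + nu%:R - 1) ^+ 2).
  by rewrite /tau -mul_polyC qE polyC_exp polyCB polyCD polyCM !polyC_natr.
have e (y : {poly rat}) : y = half * (2%:R * y).
  by rewrite mulrA mulr_natr hE mul1r.
rewrite xmE xpE [l%:R]e -[l.+1]addn1 natrD; ring.
Qed.

Lemma euler_half0 : euler_half 0 = 1.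
Proof.
have := euler_half_rec 0; rewrite big_ord1 bin0 mul1r expr0 mulr1 => e.
rewrite -[LHS]mul1r -[in LHS]half_D_half mulrDl -mulrDr e mulr_natr.
by rewrite mulr2n half_D_half.
Qed.

Lemma euler_half1 : euler_half 1 = 2%:R^-1 *: 'X.
Proof.
have := euler_half_rec 1.
rewrite big_ord_recl big_ord1 /= bin0 bin1 euler_half0 => e.
have -> : euler_half 1 = half * (euler_half 1 + euler_half 1).
  by rewrite mulrDr -mulrDl half_D_half mul1r.
have -> : euler_half 1 + euler_half 1 = 2%:R * xp - 1.
  apply: (addrI 1); rewrite [RHS]addrC subrK -[xp in RHS]expr1 -e; ring.
have -> : 2%:R * xp - 1 = (half + half) * ('X + 1) - 1.
  by rewrite /xp -mul_polyC -/half; ring.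
by rewrite half_D_half mul1r addrK mul_polyC.
Qed.

Lemma euler_half2 : euler_half 2 = 4%:R^-1 *: ('X^2 - 1).
Proof.
have := euler_half_rec 2.
rewrite !big_ord_recl big_ord0 /= /bump /= !addn0 !bin0 bin1 binn.
rewrite euler_half0 euler_half1 -mul_polyC -/half => e.
have -> : 4%:R^-1 *: ('X^2 - 1) = half ^+ 2 * ('X^2 - 1).
  by rewrite -mul_polyC /half -polyC_exp; congr (_%:P * _).
have -> : euler_half 2 = half * (euler_half 2 + euler_half 2).
  by rewrite mulrDr -mulrDl half_D_half mul1r.
have -> : euler_half 2 + euler_half 2 = 2%:R * xp ^+ 2 - 1 - 2%:R * (half * 'X).
  by rewrite -e; ring.
have -> : xp = half * ('X + 1) by rewrite mul_polyC.
transitivity (half ^+ 2 * ('X^2 - 1) +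
    (half + half - 1) * (half ^+ 2 * ('X + 1) ^+ 2 + half)); first by ring.
by rewrite half_D_half subrr mul0r addr0.
Qed.

Theorem corollary5p2 (n : nat) :
  (forall nu : nat, (nu <= 2)%N ->
     hankel n (c_seq nu) =
       (-1) ^+ 'C(n.+1, 2) * euler_half nu ^+ n.+1 *
       \prod_(1 <= l < n.+1) tau nu l ^+ (n.+1 - l))
  /\ hankel n (c_seq 0) =
       (-1) ^+ 'C(n.+1, 2) *
       \prod_(1 <= l < n.+1)
         ((l%:R ^+ 2 / 4%:R) *:
            ('X^2 - ((2%:R * l%:R - 1) ^+ 2)%:P)) ^+ (n.+1 - l)
  /\ hankel n (c_seq 1) =
       (-1) ^+ 'C(n.+1, 2) * (2%:R^-1 *: 'X) ^+ n.+1 *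
       \prod_(1 <= l < n.+1)
         ((l%:R ^+ 2 / 4%:R) *:
            ('X^2 - ((2%:R * l%:R) ^+ 2)%:P)) ^+ (n.+1 - l)
  /\ hankel n (c_seq 2) =
       (-1) ^+ 'C(n.+1, 2) * (4%:R^-1 *: ('X^2 - 1)) ^+ n.+1 *
       \prod_(1 <= l < n.+1)
         ((l%:R ^+ 2 / 4%:R) *:
            ('X^2 - ((2%:R * l%:R + 1) ^+ 2)%:P)) ^+ (n.+1 - l).
Proof.
have main nu : (nu <= 2)%N -> hankel n (c_seq nu) =
    (-1) ^+ 'C(n.+1, 2) * euler_half nu ^+ n.+1 *
    \prod_(1 <= l < n.+1) tau nu l ^+ (n.+1 - l).
  move=> le_nu2; rewrite -mulrA mulrCA -prod_triangleN.
  rewrite (hankel_decimate xmDxp half_D_half moment_euler_shift) //.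
  congr (_ * _).
  by apply: eq_bigr => i _; apply: eq_bigr => l _; rewrite tauE.
split=> //; rewrite !main // euler_half0 euler_half1 euler_half2 expr1n mulr1.
do ![split]; congr (_ * _); apply: eq_bigr => l _;
  congr ((_ *: ('X^2 - (_ ^+ 2)%:P)) ^+ _); ring.
Qed.
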